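(* Let $t$ be a positive integer and let $\lambda$ be a partition with Frobenius partition \[ \mathfrak{F}(\lambda)=\begin{pmatrix} a_1 & a_2 & \cdots & a_s\\ b_1 & b_2 & \cdots & b_s\end{pmatrix}. \] Then $\lambda$ is a $t$-core partition if and only if all of the following hold: (1) for all $i,j\in\{1,\dots,s\}$, $a_i+b_j+1\not\equiv 0 \pmod t$; (2) for each $i$, if $a_i\ge t$, then $a_i-t$ appears in the first row, i.e. $a_i-t\in\{a_1,\dots,a_s\}$; (3) for each $j$, if $b_j\ge t$, then $b_j-t$ appears in the second row, i.e. $b_j-t\in\{b_1,\dots,b_s\}$.
   Context: A partition $\lambda=(\lambda_1,\lambda_2,\dots)$ is a weakly decreasing sequence of positive integers; $\lambda'_j$ denotes the number of parts of $\lambda$ that are $\ge j$ (the length of column $j$ of the Young diagram). The hook length of box $(i,j)$ of the Young diagram is $h_{i,j}(\lambda)=(\lambda_i-i)+(\lambda'_j-j)+1$, and $\lambda$ is a $t$-core if no hook length is divisible by $t$. If $s$ is the largest integer with $\lambda_s-s\ge 0$ (the side of the Durfee square; $s=0$ for the empty partition), the Frobenius partition of $\lambda$ is the two-rowed array $\mathfrak{F}(\lambda)$ with $a_i=\lambda_i-i$ and $b_i=\lambda'_i-i$ for $i=1,\dots,s$; thus $a_1>\cdots>a_s\ge 0$ and $b_1>\cdots>b_s\ge 0$. *)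

(* Defs.v *)
From mathcomp Require Import all_boot all_order all_algebra.

Set Implicit Arguments.
Unset Strict Implicit.
Unset Printing Implicit Defensive.

Definition is_partition (lam : seq nat) : bool :=
  sorted geq lam && all (leq 1) lam.

(* Rows and columns are numbered from 1; [part lam i] is 0 past the last
   part, and the (meaningless) value at i = 0 is never used. *)
Definition part (lam : seq nat) (i : nat) : nat := nth 0 lam i.-1.

Definition conj_part (lam : seq nat) (j : nat) : nat := count (leq j) lam.

Definition in_diagram (lam : seq nat) (i j : nat) : bool :=
  (0 < i) && (0 < j <= part lam i).

(* Computed in int: below the diagonal lambda_i - i may be negative. *)
Definition hook (lam : seq nat) (i j : nat) : int :=
  (((part lam i)%:Z - i%:Z) + ((conj_part lam j)%:Z - j%:Z) + 1)%R.

Definition is_core (t : nat) (lam : seq nat) : Prop :=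
  forall i j : nat, in_diagram lam i j -> ~~ (t%:Z %| hook lam i j)%Z.

Definition durfee (lam : seq nat) : nat :=
  \max_(1 <= s < (size lam).+1 | s <= part lam s) s.

(* The subtractions are not truncated: for a partition, i <= lambda_i and
   i <= lambda'_i whenever i is at most the Durfee side. *)
Definition frobenius (lam : seq nat) : seq nat * seq nat :=
  ([seq part lam i - i | i <- iota 1 (durfee lam)],
   [seq conj_part lam i - i | i <- iota 1 (durfee lam)]).

(* Main.v *)
Require Import Defs.
From mathcomp Require Import all_boot all_order all_algebra.
From mathcomp Require Import zify.

(** Let S be the set of integers lambda_i - i (i >= 1). Its complement is
the set of integers j - 1 - lambda'_j (j >= 1), and the hook length of the box
(i, j) is the difference x - y of x = lambda_i - i in S and
y = j - 1 - lambda'_j outside S, with x > y exactly when (i, j) is in the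
diagram. Hence lambda is a t-core iff S is stable under subtraction of t. The
first Frobenius row lists the elements of S that are >= 0, and the second one
lists the numbers -1 - y for y < 0 outside S. According to the signs of x and
y, a pair x > y congruent mod t is excluded by (1), (2) or (3). *)

(** Both sides say that the box (i, j) lies in the diagram. In the induction on the parts, a first
    part below j forces all later parts below j, so the count vanishes. *)
Lemma part_geE (lam : seq nat) (i j : nat) :
    is_partition lam -> 0 < i -> 0 < j ->
  (j <= part lam i) = (i <= conj_part lam j).
Proof.
rewrite /is_partition /part /conj_part; case: i => // i + _ j0 /=.
elim: lam i => [|x lam IH] i /=; first by rewrite nth_nil leqNgt j0.
have geq_trans : transitive geq by move=> y z w /=; lia.
rewrite (path_sortedE geq_trans) => /andP[/andP[xmax lamS] /andP[_ lam1]].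
have {}IH k := IH k (introT andP (conj lamS lam1)).
case: i => [|i] /=; last first.
  rewrite IH; case: (leqP j x) => jx; first by rewrite add1n ltnS.
  have -> : count (leq j) lam = 0; last by [].
  apply/eqP; rewrite -leqn0 leqNgt -has_count; apply/hasPn => y /(allP xmax) /=.
  lia.
case: (leqP j x) => jx //; rewrite add0n -IH.
case: lam xmax {lamS lam1 IH} => [|y lam] /=; first by lia.
by case/andP; lia.
Qed.

(** Parts decrease, so the indices s with s <= [part lam s] form an initial segment, determined by
    its maximum. *)
Lemma durfee_geE (lam : seq nat) (i : nat) :
  is_partition lam -> 0 < i -> (i <= durfee lam) = (i <= part lam i).
Proof.
move=> lamP i0; apply/idP/idP => [|ile].
  rewrite /durfee; apply: contraTT; rewrite -!ltnNge => ilt.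
  rewrite -[i]prednK // ltnS; apply/bigmax_leqP_seq => s.
  rewrite mem_index_iota => /andP[s0 _] sle.
  case: (ltnP s i) => [|lis]; first by lia.
  have : part lam s <= part lam i; last by lia.
  have s1 : 0 < part lam s by lia.
  by rewrite part_geE // (leq_trans lis) // -part_geE.
rewrite /durfee; apply: (@leq_bigmax_seq _ _ _ id) => //.
rewrite mem_index_iota i0 ltnS leqNgt; apply/negP => szi.
by move: ile; rewrite /part nth_default //; lia.
Qed.

Lemma mem_frobenius1 (lam : seq nat) (x : nat) : is_partition lam ->
  reflect (exists2 i, 0 < i & part lam i = x + i) (x \in (frobenius lam).1).
Proof.
move=> lamP; apply: (iffP mapP) => [[i]|[i i0 ei]].
  rewrite mem_iota add1n ltnS => /andP[i0]; rewrite durfee_geE // => ile ->.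
  by exists i => //; rewrite subnK.
exists i; last by lia.
by rewrite mem_iota add1n ltnS i0 durfee_geE // ei leq_addl.
Qed.

Lemma mem_frobenius2 (lam : seq nat) (y : nat) : is_partition lam ->
  reflect (exists2 j, 0 < j & conj_part lam j = y + j)
          (y \in (frobenius lam).2).
Proof.
move=> lamP; apply: (iffP mapP) => [[j]|[j j0 ej]].
  rewrite mem_iota add1n ltnS => /andP[j0].
  by rewrite durfee_geE // part_geE // => jle ->; exists j => //; rewrite subnK.
exists j; last by lia.
by rewrite mem_iota add1n ltnS j0 durfee_geE // part_geE // ej leq_addl.
Qed.

(** The sum lambda_i + lambda'_j is at least i + j for a box of the diagram and at most i + j - 2
    otherwise; it skips i + j - 1. *)
Lemma part_conj_disjoint (lam : seq nat) (i j : nat) :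
    is_partition lam -> 0 < i -> 0 < j ->
  part lam i + conj_part lam j + 1 <> i + j.
Proof. by move=> lamP i0 j0; have := part_geE lam i j lamP i0 j0; lia. Qed.

(** Take the least m with lambda_m - m <= z. If equality fails, column j = z + m has length exactly
    m - 1. *)
Lemma part_conj_cover (lam : seq nat) (z : int) : is_partition lam ->
  (exists2 i, 0 < i & ((part lam i)%:Z = z + i%:Z)%R) \/
  (exists2 j, 0 < j & (j%:Z = z + (conj_part lam j)%:Z + 1)%R).
Proof.
move=> lamP; pose P i := (0 < i) && ((part lam i)%:Z <= z + i%:Z)%R.
have exP : exists i, P i.
  (* An index past the last part, where [part] is 0, and large enough that z + i >= 0. *)
  exists (size lam + `|z|%N).+1; rewrite /P /part nth_default /=; lia.
case: (ex_minnP exP) => m /andP[m0 mle] mmin.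
have [em|mlt] : ((part lam m)%:Z = z + m%:Z)%R \/
                ((part lam m)%:Z < z + m%:Z)%R by lia.
  by left; exists m.
right; pose j := `|(z + m%:Z)%R|%N.
have ej : (j%:Z = z + m%:Z)%R by rewrite /j; lia.
have j0 : 0 < j by lia.
exists j => //.
have : ~~ (m <= conj_part lam j) by rewrite -part_geE //; lia.
have : m.-1 <= conj_part lam j; last by lia.
case: (posnP m.-1) => [->//|m1]; rewrite -part_geE //.
have : ~~ P m.-1 by apply/negP => /mmin; lia.
by rewrite /P m1 /=; lia.
Qed.

Lemma sub_closed_mull (t : nat) (A : {pred nat}) (x k : nat) :
    (forall y, y \in A -> t <= y -> y - t \in A) ->
  x + k * t \in A -> x \in A.
Proof.
move=> At; elim: k => [|k IH]; first by rewrite addn0.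
move=> /At; rewrite mulSn addnCA leq_addr addKn => /(_ isT); exact: IH.
Qed.

(** The equation alone forces the box into the diagram, since outside it the left side is below i +
    j. *)
Lemma core_part_conj (t : nat) (lam : seq nat) : is_partition lam ->
  is_core t lam <->
  forall i j k, 0 < i -> 0 < j ->
    part lam i + conj_part lam j + 1 <> i + j + k.+1 * t.
Proof.
move=> lamP; split=> [core i j k i0 j0 e|ncore i j].
  have /core/negP[] : in_diagram lam i j.
    by rewrite /in_diagram i0 j0 /= part_geE //; have := part_geE lam i j lamP i0 j0; lia.
  apply/dvdzP; exists k.+1%:Z%R; rewrite /hook; lia.
rewrite /in_diagram => /and3P[i0 j0 jle]; apply/negP => /dvdzP[q].
have := jle; rewrite part_geE // => ile.
(* A hook length is positive, so the quotient can be neither zero nor negative. *)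
rewrite /hook; case: q => [[|k]|k] e; [lia| |nia].
by apply: (ncore i j k) => //; lia.
Qed.

Lemma core_frobenius (t : nat) (lam : seq nat) : is_partition lam ->
  0 < t ->
  is_core t lam <->
  [/\ forall x y, x \in (frobenius lam).1 -> y \in (frobenius lam).2 ->
        x + y + 1 <> 0 %[mod t],
      forall x, x \in (frobenius lam).1 -> t <= x ->
        x - t \in (frobenius lam).1
    & forall y, y \in (frobenius lam).2 -> t <= y ->
        y - t \in (frobenius lam).2].
Proof.
move=> lamP t0; apply: (iff_trans (core_part_conj t lam lamP)).
split=> [core|[h1 h2 h3] i j k i0 j0 e].
  split=> [x y /(mem_frobenius1 _ _ lamP)[i i0 ei]
               /(mem_frobenius2 _ _ lamP)[j j0 ej]
          |x /(mem_frobenius1 _ _ lamP)[i i0 ei] tx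
          |y /(mem_frobenius2 _ _ lamP)[j j0 ej] ty].
  - rewrite mod0n => /eqP/dvdnP[[|k] ek]; first by lia.
    by apply: (core i j k) => //; lia.
  - apply/mem_frobenius1 => //.
    (* If x - t were outside S, it would come from a column j, and the box (i, j) would have hook
       length t. *)
    have [[l l0 el]|[j j0 ej]] := part_conj_cover lam (x - t)%N%:Z%R lamP.
      by exists l => //; lia.
    by case: (core i j 0) => //; lia.
  apply/mem_frobenius2 => //.
  have [[i i0 ei]|[l l0 el]] := part_conj_cover lam (- 1 - (y - t)%N%:Z)%R lamP.
    by case: (core i j 0) => //; lia.
  by exists l => //; lia.
have mem1 : i <= part lam i -> part lam i - i \in (frobenius lam).1.
  by move=> ile; apply/mem_frobenius1 => //; exists i => //; lia.
have mem2 : j <= conj_part lam j -> conj_part lam j - j \in (frobenius lam).2.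
  by move=> jle; apply/mem_frobenius2 => //; exists j => //; lia.
case: (leqP i (part lam i)) => [ile|ilt].
  case: (leqP j (conj_part lam j)) => [jle|jlt].
    apply: (h1 _ _ (mem1 ile) (mem2 jle)).
    have -> : part lam i - i + (conj_part lam j - j) + 1 = k.+1 * t by lia.
    by rewrite modnMl mod0n.
  (* Both elements are nonnegative: descending from lambda_i - i in steps of t puts j - 1 -
     lambda'_j in S, against disjointness. *)
  have /(sub_closed_mull _ _ _ _ h2)/(mem_frobenius1 _ _ lamP)[l l0 el] :
      (j - 1 - conj_part lam j) + k.+1 * t \in (frobenius lam).1.
    by rewrite (_ : _ + _ = part lam i - i) ?mem1 //; lia.
  by apply: (part_conj_disjoint lam l j) => //; lia.
(* Now lambda_i - i is negative, hence so is the smaller j - 1 - lambda'_j; the descent takes place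
   in the second row. *)
have jle : j <= conj_part lam j by have := ltn0Sn k; nia.
have /(sub_closed_mull _ _ _ _ h3)/(mem_frobenius2 _ _ lamP)[l l0 el] :
    (i - 1 - part lam i) + k.+1 * t \in (frobenius lam).2.
  by rewrite (_ : _ + _ = conj_part lam j - j) ?mem2 //; lia.
by apply: (part_conj_disjoint lam i l) => //; lia.
Qed.

Theorem theorem1p2 (t : nat) (ht : 0 < t)
    (lam : seq nat) (hlam : is_partition lam)
    (s : nat) (a b : s.-tuple nat)
    (hF : frobenius lam = (tval a, tval b)) :
  is_core t lam <->
  [/\ forall i j : 'I_s, tnth a i + tnth b j + 1 <> 0 %[mod t],
      forall i : 'I_s, t <= tnth a i -> tnth a i - t \in a
    & forall j : 'I_s, t <= tnth b j -> tnth b j - t \in b].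
Proof.
apply: (iff_trans (core_frobenius t lam hlam ht)); rewrite hF /=.
split=> -[h1 h2 h3]; split.
- by move=> i j; apply: h1; apply: mem_tnth.
- by move=> i; apply: h2; apply: mem_tnth.
- by move=> j; apply: h3; apply: mem_tnth.
- by move=> _ _ /tnthP[i ->] /tnthP[j ->].
- by move=> _ /tnthP[i ->] /h2.
- by move=> _ /tnthP[j ->] /h3.
Qed.
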